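(* Let $L=L(u,u_1)$ be a smooth autonomous one-dimensional Lagrangian with $L_{u_1u_1}\neq 0$ everywhere on its domain, so that its equation of motion (the Euler-Lagrange equation) $\frac{d}{dx}L_{u_1}-L_u=0$ can be written as the autonomous second-order ODE $u_2=\phi(u,u_1)$ with $$\phi=\frac{L_u-u_1L_{uu_1}}{L_{u_1u_1}} .$$ Then the energy function $h(u,u_1)=u_1L_{u_1}-L$ defines the energy foliation of this ODE on $M$; that is, $dh=\mu\,\omega^3$ for a non-vanishing smooth function $\mu$, where $\omega^3=-\frac{\phi}{u_1}\,du+du_1$, so that the leaves of the energy foliation are given locally by the level sets of $h$.
   Context: $J^1(\mathbb R,\mathbb R)$ is the first-order jet bundle, identified with $\mathbb R^3$ with standard coordinates $(x,u,u_1)$; here $x$ is time, $u$ the generalized coordinate and $u_1$ the generalized velocity. Subscripts denote partial derivatives, and $\frac{d}{dx}$ is the total derivative, so the Euler-Lagrange equation expands to $u_1L_{uu_1}+u_2L_{u_1u_1}-L_u=0$. For an autonomous second-order ODE $u_2=\phi(u,u_1)$ with $\phi$ smooth on an open set $U\subseteq J^1(\mathbb R,\mathbb R)$, put $M=\{(x,u,u_1)\in U:u_1\neq 0\}$ and $\omega^3=-\frac{\phi}{u_1}\,du+du_1$ on $M$. The distribution $D_p=\{v\in T_pM:\omega^3_p(v)=0\}$ is involutive (it is spanned by $e_1=\partial_x+u_1\partial_u+\phi\,\partial_{u_1}$ and $e_2=\partial_u+\frac{\phi}{u_1}\partial_{u_1}$), and the energy foliation $\mathcal E$ of the ODE is the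 foliation of $M$ whose leaf through $p$ has tangent space $D_p$ at $p$. A smooth function $E$ is said to define the energy foliation (locally) if $dE=\mu\,\omega^3$ for some non-vanishing smooth function $\mu$; equivalently, the leaves are locally the level sets $\{E=C\}$, $C\in\mathbb R$, with $dE\ne 0$. *)

(* Defs.v *)
From HB Require Import structures.
From mathcomp Require Import all_boot all_order all_algebra.
From mathcomp Require Import all_classical all_reals all_analysis.

Set Implicit Arguments.
Unset Strict Implicit.
Unset Printing Implicit Defensive.

Import Order.TTheory GRing.Theory Num.Theory.
Import numFieldNormedType.Exports.

Local Open Scope classical_set_scope.
Local Open Scope ring_scope.

Section Smooth.
Context {R : realType} {n : nat} {W : normedModType R}.

(* All iterated directional derivatives up to order [k] are differentiable
   on [A]; [A] is meant to be open, so that only values on [A] matter. *)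
Fixpoint differentiable_upto (k : nat) (A : set 'rV[R]_n)
    (f : 'rV[R]_n -> W) : Prop :=
  (forall p, A p -> differentiable f p) /\
  (if k is k'.+1 then
     forall v : 'rV[R]_n, differentiable_upto k' A (fun p => 'D_v f p)
   else True).

Definition smooth_on (A : set 'rV[R]_n) (f : 'rV[R]_n -> W) : Prop :=
  forall k, differentiable_upto k A f.

End Smooth.

Section JetSpace.
Context {R : realType}.

(* J^1(R, R) is 'rV[R]_3, with coordinates (x, u, u_1) in this order. *)
Local Notation J1 := 'rV[R]_3.

Definition ix : 'I_3 := @Ordinal 3 0 isT.
Definition iu : 'I_3 := @Ordinal 3 1 isT.
Definition iu1 : 'I_3 := @Ordinal 3 2 isT.

Definition ucoord (p : J1) : R := p ord0 iu.
Definition u1coord (p : J1) : R := p ord0 iu1.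

Definition partial (i : 'I_3) (f : J1 -> R) (p : J1) : R :=
  'D_(delta_mx ord0 i) f p.

Definition autonomous_on (U : set J1) (f : J1 -> R) : Prop :=
  forall p q, U p -> U q ->
    ucoord p = ucoord q -> u1coord p = u1coord q -> f p = f q.

(* The total derivative of a function on J^1, at the second-order jet with
   coordinates (p, u2). *)
Definition total_derivative (f : J1 -> R) (p : J1) (u2 : R) : R :=
  partial ix f p + u1coord p * partial iu f p + u2 * partial iu1 f p.

Definition euler_lagrange (L : J1 -> R) (p : J1) (u2 : R) : Prop :=
  total_derivative (partial iu1 L) p u2 - partial iu L p = 0.

(* [partial iu1 (partial iu L)] is L_{u u_1}: subscripts are read from left
   to right. *)
Definition lagrange_phi (L : J1 -> R) (p : J1) : R :=
  (partial iu L p - u1coord p * partial iu1 (partial iu L) p)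
    / partial iu1 (partial iu1 L) p.

Definition energy_function (L : J1 -> R) (p : J1) : R :=
  u1coord p * partial iu1 L p - L p.

End JetSpace.

Record surface (R : realType) := Surface {
  surface_dom : set 'rV[R]_2;
  surface_map : 'rV[R]_2 -> 'rV[R]_3 }.

Section Foliation.
Context {R : realType}.
Variables (M : set 'rV[R]_3) (D : 'rV[R]_3 -> set 'rV[R]_3).

(* A parametrized piece of a two-dimensional integral manifold. The image of
   the differential is the whole of [D], so that the map is an immersion when
   [D] has rank two. *)
Definition integral_chart (c : surface R) : Prop :=
  [/\ open (surface_dom c),
      smooth_on (surface_dom c) (surface_map c),
      {in surface_dom c &, injective (surface_map c)},
      surface_map c @` surface_dom c `<=` M &
      forall b, surface_dom c b ->
        range ('d (surface_map c) b) = D (surface_map c b)].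

(* An immersed integral manifold is encoded by an atlas of charts with open
   transition domains and homeomorphic (hence smooth, the charts being
   immersions) transition maps. Its own topology is the one making the charts
   homeomorphisms onto open sets; it may be finer than that of R^3. *)
Definition integral_atlas (A : set (surface R)) : Prop :=
  (forall c, A c -> integral_chart c) /\
  (forall c c' (O : set 'rV[R]_2),
     A c -> A c' -> open O -> O `<=` surface_dom c' ->
     open (surface_dom c `&` surface_map c @^-1` (surface_map c' @` O))).

Definition support_of_atlas (A : set (surface R)) : set 'rV[R]_3 :=
  \bigcup_(c in A) (surface_map c @` surface_dom c).

(* Connectedness for the manifold topology, not for that of R^3. *)
Definition connected_atlas (A : set (surface R)) : Prop :=
  forall S : set 'rV[R]_3,
    (forall c, A c ->
       open (surface_dom c `&` surface_map c @^-1` S) /\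
       open (surface_dom c `&` surface_map c @^-1` (~` S))) ->
    support_of_atlas A `<=` S \/ support_of_atlas A `<=` ~` S.

(* The leaf through [p]: the union of all connected integral manifolds through
   [p], which, for an involutive distribution, is the maximal one. *)
Definition leaf (p : 'rV[R]_3) : set 'rV[R]_3 :=
  [set q | exists A, [/\ integral_atlas A, connected_atlas A,
                         support_of_atlas A p & support_of_atlas A q]].

End Foliation.

Section EnergyFoliation.
Context {R : realType}.
Variables (U : set 'rV[R]_3) (phi : 'rV[R]_3 -> R).

Definition energy_domain : set 'rV[R]_3 := [set p | U p /\ u1coord p != 0].

(* A tangent vector [v] at [p] has components dx(v), du(v), du_1(v). *)
Definition omega3 (p v : 'rV[R]_3) : R :=
  - (phi p / u1coord p) * v ord0 iu + v ord0 iu1.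

Definition energy_distribution (p : 'rV[R]_3) : set 'rV[R]_3 :=
  [set v | omega3 p v = 0].

Definition energy_leaf : 'rV[R]_3 -> set 'rV[R]_3 :=
  leaf energy_domain energy_distribution.

Definition defines_energy_foliation (E : 'rV[R]_3 -> R) : Prop :=
  smooth_on energy_domain E /\
  exists mu : 'rV[R]_3 -> R,
    [/\ smooth_on energy_domain mu,
        forall p, energy_domain p -> mu p != 0 &
        forall p, energy_domain p ->
          forall v, 'd E p v = mu p * omega3 p v].

Definition leaves_locally_level_sets (E : 'rV[R]_3 -> R) : Prop :=
  forall p, energy_domain p ->
    (exists v, 'd E p v != 0) /\
    exists W : set 'rV[R]_3,
      [/\ open W, W p, W `<=` energy_domain &
          forall q, W q ->
            energy_leaf q `&` W = [set r | W r /\ E r = E q]].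

End EnergyFoliation.

(* Main.v *)
(** Since [L] does not depend on [x] and mixed partials commute,
    [dh = u_1 L_{u_1 u_1} (- phi / u_1 du + du_1)], which is [mu omega^3] with
    [mu = u_1 L_{u_1 u_1} <> 0]. Hence [h] has zero derivative along every
    integral manifold, so it is constant on the connected ones and thus on each
    leaf. Conversely, since [h_{u_1} = mu <> 0], near a point every level set
    of [h] is a graph [u_1 = g(x, u)] over one fixed box, and [dh = mu omega^3]
    forces [dg = (phi / u_1) du] there: the graph is a connected integral
    manifold, so it lies in a single leaf. *)

Require Import Defs.
From mathcomp Require Import all_boot all_order all_algebra.
From mathcomp Require Import all_classical all_reals all_analysis.
From mathcomp Require Import ring lra.
Set Implicit Arguments.
Unset Strict Implicit.
Unset Printing Implicit Defensive.
Import Order.TTheory GRing.Theory Num.Theory.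
Import numFieldNormedType.Exports.
Local Open Scope classical_set_scope.
Local Open Scope ring_scope.

(** * Differentiability along all iterated directional derivatives *)

Section Calculus.
Context {R : realType}.

(** [L] is a total function controlled only on the open set [U], so each rule of calculus is proved
    for [differentiable_upto] on an open set and carried along equalities that hold there. The
    level-set half uses nothing of the Lagrangian beyond [dh = mu omega^3] and is stated for any
    such [E]. Its difficulty is uniformity: one neighbourhood must serve all nearby levels. The
    heights [g] are therefore found by monotonicity of [E] in [u_1] and the intermediate value
    theorem, over the same ball of the [(x, u)]-plane for every level; regularity comes afterwards.
    The mean value theorem for [E] makes [g] differentiable, and [dg = psi du] with
    [psi = phi / u_1] taken along the graph, so each order of differentiability of [g] gives the
    next. A leaf may leave the neighbourhood and return; since [E] is constant on the whole leaf,
    every return lands on the same graph. *)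

Lemma near_eq_diff (V W : normedModType R) (f g : V -> W) (a : V) :
  (\near a, f a = g a) -> differentiable f a ->
  differentiable g a /\ 'd g a = 'd f a :> (V -> W).
Proof.
move=> fg df.
have ga : g a = f a by rewrite (nbhs_singleton fg).
have H : g \o shift a = cst (g a) + 'd f a +o_ 0 id.
  apply/eqaddoP => e e0.
  have /eqaddoP/(_ _ e0) := diff_locally df.
  rewrite ga => fe.
  have fg0 : \forall h \near 0, f (h + a) = g (h + a).
    move/nbhs_normP: fg => [r /= r0 fg]; apply/nbhs_normP; exists r => //= h /=.
    rewrite sub0r normrN => hr; apply: fg => /=.
    by rewrite opprD addrCA subrr addr0 normrN.
  by apply: filterS2 fe fg0 => h + fgh; rewrite !fctE /= fgh; apply.
have dE : 'd g a = 'd f a :> (V -> W) by apply: diff_unique H; exact: diff_continuous.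
by split=> //; apply/diff_locallyP; rewrite dE; split=> //; exact: diff_continuous.
Qed.

Lemma diff_sum_partial n (f : 'rV[R]_n -> R) p v : differentiable f p ->
  'd f p v = \sum_i v ord0 i * 'D_(delta_mx ord0 i) f p.
Proof.
move=> df; rewrite {1}(row_sum_delta v) linear_sum; apply: eq_bigr => i _.
by rewrite linearZ deriveE.
Qed.

(** The one-variable mean value theorem for [f] along the affine path from [p] to [q]. *)
Lemma segment_MVT (V : normedModType R) (f : V -> R) (p q : V) :
  (forall t : R, 0 <= t <= 1 -> differentiable f (p + t *: (q - p))) ->
  exists2 t : R, 0 <= t <= 1 & f q - f p = 'd f (p + t *: (q - p)) (q - p).
Proof.
move=> df.
pose l (t : R) : V := p + t *: (q - p).
have dl (t : R) : is_diff t l (fun h : R => h *: (q - p)).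
  by apply: is_diff_eq; rewrite add0r.
have dfl (t : R) : 0 <= t <= 1 -> is_derive t 1 (f \o l) ('d f (l t) (q - p)).
  move=> t01.
  have dfl : differentiable (f \o l) t.
    by apply: differentiable_comp; [exact: ex_diff|exact: df].
  apply: DeriveDef; first exact: diff_derivable.
  rewrite deriveE // diff_comp //=; last exact: df.
  by rewrite diff_val scale1r.
have [t||c c01] := @MVT_segment R (f \o l) (fun t : R => 'd f (l t) (q - p)) 0 1 ler01.
- by rewrite in_itv /= => /andP[t0 t1]; apply: dfl; rewrite !ltW.
- apply: derivable_within_continuous => t; rewrite in_itv /= => t01.
  by have := dfl t t01; case.
rewrite /= /l scale1r scale0r addr0 subrKC subr0 mulr1 => E.
by exists c.
Qed.

End Calculus.

Section Upto.
Context {R : realType}.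

Section Codomain.
Context {n : nat} {W : normedModType R}.
Implicit Types (A : set 'rV[R]_n) (f g : 'rV[R]_n -> W).

Lemma upto_differentiable k A f p :
  A p -> differentiable_upto k A f -> differentiable f p.
Proof. by move=> Ap; case: k => [|k] [df _]; exact: df. Qed.

Lemma uptoW k A f : differentiable_upto k.+1 A f -> differentiable_upto k A f.
Proof.
elim: k f => [|k IH] f [df Df]; split=> // v.
exact: IH (Df v).
Qed.

Lemma uptoS k A B f : A `<=` B ->
  differentiable_upto k B f -> differentiable_upto k A f.
Proof.
move=> AB; elim: k f => [|k IH] f [df Df]; (split; first by move=> p /AB/df) => // v.
exact: IH (Df v).
Qed.

(** Since [A] is open, agreement on [A] is agreement near each of its points, hence passes to every
    directional derivative. This is what lets formulas valid only on [A] replace a derivative. *)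
Lemma upto_eq k A f g : open A -> (forall p, A p -> f p = g p) ->
  differentiable_upto k A f -> differentiable_upto k A g.
Proof.
move=> oA; have nfg h1 h2 p : (forall p, A p -> h1 p = h2 p) -> A p ->
    \forall q \near p, h1 q = h2 q :> W.
  by move=> fg Ap; apply: filterS (open_nbhs_nbhs (conj oA Ap)).
elim: k f g => [|k IH] f g fg [df Df];
  (split; first by move=> p Ap;
    have [] := near_eq_diff (nfg _ _ _ fg Ap) (df p Ap)) => // v.
apply: (IH ('D_v f)) (Df v) => p Ap.
exact: near_eq_derive (nfg _ _ _ fg Ap).
Qed.

Lemma upto_cst k A (c : W) : differentiable_upto k A (cst c).
Proof.
elim: k c => [|k IH] c; split=> // v.
rewrite (_ : 'D_v _ = cst 0); first exact: IH.
by apply/funext => p; exact: derive_cst.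
Qed.

Lemma uptoD k A f g : open A -> differentiable_upto k A f ->
  differentiable_upto k A g -> differentiable_upto k A (f + g).
Proof.
move=> oA; elim: k f g => [|k IH] f g [df Df] [dg Dg];
  (split; first by move=> p Ap; apply: differentiableD; [exact: df|exact: dg]) => // v.
apply: upto_eq (IH _ _ (Df v) (Dg v)) => // p Ap.
by rewrite deriveD//; apply: diff_derivable; [exact: df|exact: dg].
Qed.

End Codomain.

Section Scalar.
Context {n : nat}.
Implicit Types (A : set 'rV[R]_n) (f g : 'rV[R]_n -> R).

Lemma uptoM k A f g : open A -> differentiable_upto k A f ->
  differentiable_upto k A g -> differentiable_upto k A (f * g).
Proof.
move=> oA; elim: k f g => [|k IH] f g hf hg.
  split=> // p Ap.
  by apply: differentiableM;
    [exact: upto_differentiable Ap hf|exact: upto_differentiable Ap hg].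
split=> [p Ap|v].
  by apply: differentiableM;
    [exact: upto_differentiable Ap hf|exact: upto_differentiable Ap hg].
apply: (@upto_eq _ _ _ _ (f * 'D_v g + g * 'D_v f)) => // [p Ap|].
  by rewrite deriveM//; apply: diff_derivable;
    [exact: upto_differentiable Ap hf|exact: upto_differentiable Ap hg].
by apply: uptoD => //; apply: IH; [exact: uptoW|exact: hg.2|exact: uptoW|exact: hf.2].
Qed.

Lemma uptoN k A f : open A -> differentiable_upto k A f ->
  differentiable_upto k A (- f).
Proof.
move=> oA hf; rewrite (_ : - f = cst (-1) * f); last first.
  by apply/funext => p; rewrite !fctE mulN1r.
by apply: uptoM => //; exact: upto_cst.
Qed.

Lemma uptoB k A f g : open A -> differentiable_upto k A f ->
  differentiable_upto k A g -> differentiable_upto k A (f - g).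
Proof. by move=> oA hf hg; apply: uptoD => //; exact: uptoN. Qed.

(** The derivative of [1 / f] is [- (1 / f)^2] times that of [f], so order [k] for [1 / f] itself
    yields order [k + 1]. *)
Lemma uptoV k A f : open A -> (forall p, A p -> f p != 0) ->
  differentiable_upto k A f -> differentiable_upto k A (fun p => (f p)^-1).
Proof.
move=> oA f0; elim: k => [|k IH] hf.
  split=> // p Ap.
  by apply: differentiableV (f0 _ Ap); exact: upto_differentiable Ap hf.
split=> [p Ap|v].
  by apply: differentiableV (f0 _ Ap); exact: upto_differentiable Ap hf.
pose i p := (f p)^-1.
have hi : differentiable_upto k A i by exact/IH/uptoW.
apply: (@upto_eq _ _ _ _ (- (i * i * 'D_v f))) => // [p Ap|].
  rewrite deriveV ?f0//; last by apply: diff_derivable; exact: upto_differentiable Ap hf.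
  by rewrite scaleNr !fctE -exprVn expr2.
by apply: uptoN => //; apply: uptoM => //; [exact: uptoM|exact: hf.2].
Qed.

End Scalar.

Section Matrix.
Context {n m : nat}.
Implicit Types (A : set 'rV[R]_n) (G : 'rV[R]_n -> 'rV[R]_m).

Lemma differentiable_rowP G p :
  differentiable G p <-> forall i, differentiable (fun q => G q ord0 i) p.
Proof.
split=> [dG i|dG].
  exact: differentiable_comp dG (differentiable_coord _ _ _).
rewrite (_ : G = \sum_i (fun q => G q ord0 i *: delta_mx ord0 i)).
  by apply: differentiable_sum => i; apply: differentiableZl.
by apply/funext => q; rewrite fct_sumE -row_sum_delta.
Qed.

Lemma derive_row G p v i : differentiable G p ->
  'D_v G p ord0 i = 'D_v (fun q => G q ord0 i) p.
Proof. by move=> dG; rewrite derive_mx ?mxE//; exact: diff_derivable. Qed.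

Lemma upto_rowP k A G : open A ->
  differentiable_upto k A G <->
  forall i, differentiable_upto k A (fun q => G q ord0 i).
Proof.
move=> oA; elim: k G => [|k IH] G; split.
- by case=> dG _ i; split=> // p /dG /differentiable_rowP.
- by move=> dG; split=> // p Ap; apply/differentiable_rowP => i; apply: (dG i).1.
- case=> dG DG i; split=> [p /dG/differentiable_rowP//|v].
  apply: upto_eq ((IH _).1 (DG v) i) => // p Ap.
  by rewrite derive_row//; exact: dG.
- move=> dG.
  have dG' p : A p -> differentiable G p.
    by move=> Ap; apply/differentiable_rowP => i; apply: (dG i).1.
  split=> // v; apply/IH => i; apply: upto_eq ((dG i).2 v) => // p Ap.
  by rewrite derive_row//; exact: dG'.
Qed.

(** By the chain rule, a derivative of [f \o G] is a sum of products of a derivative of a component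
    of [G] with a partial derivative of [f] composed with [G]. Only [G] is limited to order [k],
    which is what the bootstrap in [smooth_graph] requires. *)
Lemma upto_comp k A (B : set 'rV[R]_m) (f : 'rV[R]_m -> R) G : open A ->
  smooth_on B f -> (forall p, A p -> B (G p)) -> differentiable_upto k A G ->
  differentiable_upto k A (f \o G).
Proof.
move=> oA + AB; elim: k f => [|k IH] f sf hG.
  split=> // p Ap.
  by apply: differentiable_comp;
    [exact: upto_differentiable Ap hG|exact: (sf 0%N).1 (AB _ Ap)].
have dG p : A p -> differentiable G p by move=> Ap; exact: upto_differentiable Ap hG.
have df p : A p -> differentiable f (G p) by move=> /AB; exact: (sf 0%N).1.
split=> [p Ap|v]; first by apply: differentiable_comp; [exact: dG|exact: df].
have fG p : A p -> (\sum_i ((fun q => 'D_v G q ord0 i) *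
    ('D_(delta_mx ord0 i) f \o G))) p = 'D_v (f \o G) p.
  move=> Ap; rewrite deriveE; last by apply: differentiable_comp; [exact: dG|exact: df].
  rewrite diff_comp; [|exact: dG|exact: df].
  rewrite /= diff_sum_partial; last exact: df.
  by rewrite fct_sumE; apply: eq_bigr => i _; rewrite -deriveE//; exact: dG.
apply: upto_eq fG _ => //.
elim/big_ind: _ => [|g h|i _].
- exact: upto_cst.
- exact: uptoD.
apply: uptoM => //; first exact: (upto_rowP _ _ oA).1 (hG.2 v) i.
apply: IH; last exact: uptoW.
by move=> j; exact: (sf j.+1).2.
Qed.

End Matrix.

Lemma upto_coord n k (A : set 'rV[R]_n) i : open A ->
  differentiable_upto k A (fun q : 'rV[R]_n => q ord0 i).
Proof.
move=> oA; case: k => [|k];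
  (split; first by move=> p _; exact: differentiable_coord) => // v.
apply: (@upto_eq _ _ _ _ (cst (v ord0 i))) (upto_cst _ _ _) => // p Ap.
by rewrite -(@derive_row n n id) ?derive_id.
Qed.

End Upto.

(** * Symmetry of second derivatives *)

Section Schwarz.
Context {R : realType} {n : nat}.
Implicit Types (U : set 'rV[R]_n) (f : 'rV[R]_n -> R).

Lemma differentiable_shift f p c :
  differentiable f (p + c) -> differentiable (fun q => f (q + c)) p.
Proof. by move=> df; apply: differentiable_comp. Qed.

Lemma derive_translate f p c v : 'D_v (fun q => f (q + c)) p = 'D_v f (p + c).
Proof.
rewrite /derive; congr (lim (_ @ 0^')); apply/funext => h /=.
by rewrite addrA.
Qed.

(** Two mean value theorems: for [f (q + t *: w) - f q] along [v], then for ['D_v f] along [w]. The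
    bound on [t] keeps the whole parallelogram in the ball. *)
Lemma second_difference U f (p v w : 'rV[R]_n) (r t : R) : 0 <= t ->
  (forall q, `|q - p| < r -> U q) -> t * (`|v| + `|w|) < r ->
  differentiable_upto 1 U f ->
  exists2 q, `|q - p| < r &
    f (p + t *: v + t *: w) - f (p + t *: v) - (f (p + t *: w) - f p) =
    t ^+ 2 * 'D_w ('D_v f) q.
Proof.
move=> t0 Ur tr [df Df].
have near_p (a b : R) : 0 <= a <= 1 -> 0 <= b <= 1 ->
    `|p + a *: (t *: v) + b *: (t *: w) - p| < r.
  move=> /andP[a0 a1] /andP[b0 b1]; apply: le_lt_trans tr.
  rewrite -[p + _ + _]addrA addrAC subrr add0r mulrDr (le_trans (ler_normD _ _))//.
  by rewrite !normrZ (ger0_norm a0) (ger0_norm b0) (ger0_norm t0) lerD//;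
    rewrite ler_piMl// mulr_ge0.
have Up (a b : R) (a01 : 0 <= a <= 1) (b01 : 0 <= b <= 1) := Ur _ (near_p a b a01 b01).
have addK (x y : 'rV[R]_n) : x + y - x = y by rewrite addrAC subrr add0r.
have b0 : 0 <= (0 : R) <= 1 by rewrite lexx ler01.
have b1 : 0 <= (1 : R) <= 1 by rewrite lexx ler01.
pose g (q : 'rV[R]_n) := f (q + t *: w) - f q.
have dg (a : R) : 0 <= a <= 1 -> differentiable g (p + a *: (t *: v)).
  move=> a01; apply: differentiableB.
    apply: differentiable_shift; have := Up a 1 a01 b1.
    by rewrite scale1r => /df.
  by have := Up a 0 a01 b0; rewrite scale0r addr0 => /df.
have [a|a a01] := @segment_MVT R _ g p (p + t *: v).
  by rewrite addK => /dg.
rewrite addK {1}/g => ->.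
have := Up a 0 a01 b0; have := Up a 1 a01 b1.
rewrite scale0r addr0 scale1r => U1 U0.
rewrite linearZ -deriveE; last exact: dg.
rewrite deriveB; last 2 first.
- by apply/diff_derivable/differentiable_shift/df.
- exact/diff_derivable/df.
rewrite derive_translate.
set q := p + a *: (t *: v).
have [b b01|b b01 ->] := @segment_MVT R _ ('D_v f) q (q + t *: w).
  by rewrite addK; apply: (Df v).1; exact: Up.
rewrite addK; exists (q + b *: (t *: w)); first exact: near_p.
rewrite linearZ -deriveE; last by apply: (Df v).1; exact: Up.
by rewrite expr2 -mulrA.
Qed.

(** The second difference is symmetric in [v] and [w], so the two mixed derivatives take a common
    value at two points [q1], [q2] close to [p]; their continuity at [p] concludes. *)
Lemma derive_comm U f (p v w : 'rV[R]_n) : open U -> U p -> differentiable_upto 2 U f ->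
  'D_w ('D_v f) p = 'D_v ('D_w f) p.
Proof.
move=> oU Up hf; have ac (a b c d : R) : a - b - (c - d) = a - c - (b - d) by ring.
have near_eq (a b c e : R) : `|a - c| < e / 2 -> `|b - c| < e / 2 -> `|a - b| <= e.
  move=> ac2; rewrite distrC => bc2.
  by rewrite -(subrKA c) (le_trans (ler_normD _ _))// [leRHS](splitr e) ltW// ltrD.
apply/eqP; rewrite -subr_eq0 -normr_le0.
apply/ler_addgt0Pr => e e0; rewrite add0r.
have cont v' w' : {for p, continuous ('D_w' ('D_v' f))}.
  exact/differentiable_continuous/((hf.2 v').2 w').1.
have e20 : 0 < e / 2 by rewrite divr_gt0.
have : \forall q \near p, [/\ U q, `|'D_w ('D_v f) p - 'D_w ('D_v f) q| < e / 2 &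
    `|'D_v ('D_w f) p - 'D_v ('D_w f) q| < e / 2].
  have h1 := open_nbhs_nbhs (conj oU Up).
  have h2 : \forall q \near p, `|'D_w ('D_v f) p - 'D_w ('D_v f) q| < e / 2.
    by move/cvgrPdist_lt: (cont v w) => /(_ _ e20).
  have h3 : \forall q \near p, `|'D_v ('D_w f) p - 'D_v ('D_w f) q| < e / 2.
    by move/cvgrPdist_lt: (cont w v) => /(_ _ e20).
  apply: filterS (filterI h1 (filterI h2 h3)) => q [? [? ?]]; split=> //.
move=> /nbhs_normP[r /= r0 rP].
have rP' q : `|q - p| < r -> [/\ U q, `|'D_w ('D_v f) p - 'D_w ('D_v f) q| < e / 2 &
    `|'D_v ('D_w f) p - 'D_v ('D_w f) q| < e / 2].
  by rewrite distrC => /rP.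
(* The [+ 1] keeps the denominator positive when [v] and [w] vanish and makes the bound on the
   parallelogram strict. *)
pose t := r / (`|v| + `|w| + 1).
have s0 : 0 < `|v| + `|w| + 1 by rewrite ltr_pwDr// addr_ge0.
have t0 : 0 < t by rewrite divr_gt0.
have tr : t * (`|v| + `|w|) < r.
  by rewrite /t mulrAC ltr_pdivrMr// ltr_pM2l// ltrDl.
have Ur q : `|q - p| < r -> U q by move=> /rP'[].
have [q1 q1r E1] := second_difference (ltW t0) Ur tr (uptoW hf).
have tr' : t * (`|w| + `|v|) < r by rewrite [`|w| + _]addrC.
have [q2 q2r E2] := second_difference (ltW t0) Ur tr' (uptoW hf).
have [_ h1 _] := rP' _ q1r; have [_ _ h2] := rP' _ q2r.
have E : 'D_w ('D_v f) q1 = 'D_v ('D_w f) q2.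
  apply: (@mulfI _ (t ^+ 2)); first by rewrite expf_neq0 ?gt_eqF.
  by apply: etrans (esym E1) (etrans _ E2); rewrite ac [in RHS](addrAC p).
rewrite -E in h2; exact: near_eq h1 h2.
Qed.

End Schwarz.

(** * Energy of an autonomous Lagrangian *)

Section Smooth.
Context {R : realType} {n : nat}.
Implicit Types (A : set 'rV[R]_n) (f g : 'rV[R]_n -> R).

Lemma smooth_derive A f v : smooth_on A f -> smooth_on A ('D_v f).
Proof. by move=> sf k; exact: (sf k.+1).2. Qed.

Lemma smoothS A B f : A `<=` B -> smooth_on B f -> smooth_on A f.
Proof. by move=> AB sf k; exact: uptoS AB (sf k). Qed.

Lemma smoothB A f g : open A -> smooth_on A f -> smooth_on A g ->
  smooth_on A (fun p => f p - g p).
Proof. by move=> oA sf sg k; exact: uptoB. Qed.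

Lemma smoothM A f g : open A -> smooth_on A f -> smooth_on A g ->
  smooth_on A (fun p => f p * g p).
Proof. by move=> oA sf sg k; exact: uptoM. Qed.

Lemma smooth_div A f g : open A -> (forall p, A p -> g p != 0) ->
  smooth_on A f -> smooth_on A g -> smooth_on A (fun p => f p / g p).
Proof. by move=> oA g0 sf sg k; apply: uptoM => //; exact: uptoV. Qed.

Lemma smooth_coord A i : open A -> smooth_on A (fun p => p ord0 i).
Proof. by move=> oA k; exact: upto_coord. Qed.

Lemma smooth_differentiable A f p : smooth_on A f -> A p -> differentiable f p.
Proof. by move=> sf Ap; exact: upto_differentiable Ap (sf 0%N). Qed.

End Smooth.

Section Energy.
Context {R : realType}.
Local Notation J1 := 'rV[R]_3.
Implicit Types (U : set J1) (f L : J1 -> R).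

Lemma diff_partials f (p v : J1) : differentiable f p ->
  'd f p v = v ord0 ix * partial ix f p + v ord0 iu * partial iu f p +
             v ord0 iu1 * partial iu1 f p.
Proof.
move=> df; rewrite (diff_sum_partial v df).
have E (F : 'I_3 -> R) : \sum_i F i = F ix + F iu + F iu1.
  rewrite !big_ord_recl big_ord0 addr0 addrA.
  by congr (F _ + F _ + F _); exact/val_inj.
exact: E.
Qed.

Lemma open_energy_domain U : open U -> open (energy_domain U).
Proof.
move=> oU.
rewrite (_ : energy_domain U = U `&` u1coord @^-1` [set x : R | x != 0])//.
apply: openI => //.
by apply: open_comp; [move=> p _; exact: coord_continuous|exact: open_neq].
Qed.

(** The vector [q - p] has no [u] or [u_1] component, so [f] agrees near [p] with its translate by
    [q - p], whose derivative at [p] is that of [f] at [q]. *)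
Lemma autonomous_derive U f (v : J1) :
  open U -> autonomous_on U f -> autonomous_on U ('D_v f).
Proof.
move=> oU af p q Up Uq pqu pqu1.
rewrite -(subrKC p q) -derive_translate.
apply: near_eq_derive.
have Uqp : \forall r \near p, U (r + (q - p)).
  have c : {for p, continuous (fun r : J1 => r + (q - p))}.
    by apply: differentiable_continuous; exact: differentiableD.
  by apply: (c U); rewrite /= subrKC; exact: open_nbhs_nbhs.
near=> r; apply: af.
- by near: r; exact: open_nbhs_nbhs.
- by near: r.
- by rewrite /ucoord !mxE -/(ucoord p) -/(ucoord q) pqu subrr addr0.
- by rewrite /u1coord !mxE -/(u1coord p) -/(u1coord q) pqu1 subrr addr0.
Unshelve. all: by end_near. Qed.

Lemma autonomous_partial_x U f p :
  open U -> autonomous_on U f -> U p -> partial ix f p = 0.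
Proof.
move=> oU af Up; rewrite /partial /derive; apply: cvg_lim => //.
apply: cvg_near_cst; apply: nbhs_dnbhs.
have Uh : \forall h \near (0 : R), U (h *: delta_mx ord0 ix + p).
  have c : {for 0, continuous (fun h : R => h *: (delta_mx ord0 ix : J1) + p)}.
    by apply: differentiable_continuous; exact: differentiableD.
  by apply: (c U); rewrite /= scale0r add0r; exact: open_nbhs_nbhs.
near=> h; rewrite /= (af (h *: delta_mx ord0 ix + p) p) ?subrr ?scaler0//.
- by near: h.
- by rewrite /ucoord !mxE/= mulr0 add0r.
- by rewrite /u1coord !mxE/= mulr0 add0r.
Unshelve. all: by end_near. Qed.

Lemma autonomous_partial U f i :
  open U -> autonomous_on U f -> autonomous_on U (partial i f).
Proof. exact: autonomous_derive. Qed.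

Lemma smooth_partial U f i : smooth_on U f -> smooth_on U (partial i f).
Proof. exact: smooth_derive. Qed.

Lemma partial_comm U L i j p : open U -> smooth_on U L -> U p ->
  partial i (partial j L) p = partial j (partial i L) p.
Proof. by move=> oU sL Up; exact: derive_comm oU Up (sL 2%N). Qed.

Lemma smooth_lagrange_phi U L : open U -> smooth_on U L ->
  (forall p, U p -> partial iu1 (partial iu1 L) p != 0) ->
  smooth_on U (lagrange_phi L).
Proof.
move=> oU sL Lreg; apply: smooth_div => //; last by do 2!apply: smooth_partial.
apply: smoothB; [by []|exact: smooth_partial|].
by apply: smoothM; [by []|exact: smooth_coord|do 2!apply: smooth_partial].
Qed.

Lemma smooth_energy_function U L : open U -> smooth_on U L ->
  smooth_on U (energy_function L).
Proof.
move=> oU sL; apply: smoothB => //.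
by apply: smoothM; [by []|exact: smooth_coord|exact: smooth_partial].
Qed.

Lemma autonomous_lagrange_phi U L : open U -> autonomous_on U L ->
  autonomous_on U (lagrange_phi L).
Proof.
move=> oU aL p q Up Uq pqu pqu1; rewrite /lagrange_phi pqu1.
have a i f := @autonomous_partial U f i oU.
have e1 := a iu _ aL p q Up Uq pqu pqu1.
have e2 := a iu1 _ (a iu _ aL) p q Up Uq pqu pqu1.
have e3 := a iu1 _ (a iu1 _ aL) p q Up Uq pqu pqu1.
suff E (a1 a2 b1 b2 c1 c2 u : R) : a1 = a2 -> b1 = b2 -> c1 = c2 ->
    (a1 - u * b1) / c1 = (a2 - u * b2) / c2 by exact: E e1 e2 e3.
by move=> -> -> ->.
Qed.

(** Here [x] stands for the [x]-derivative of [L_{u_1}], while [b] and [b'] are the mixed partial in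
    its two orders: the total derivative produces one, [lagrange_phi] contains the other. *)
Fact solve_euler_lagrange (x a b b' c u u2 : R) : x = 0 -> b = b' -> c != 0 ->
  x + u * b + u2 * c - a = 0 <-> u2 = (a - u * b') / c.
Proof.
move=> -> <- c0; rewrite add0r; split=> [E|->]; last by rewrite divfK//; ring.
by apply: (mulIf c0); rewrite divfK//; move: E; lra.
Qed.

Lemma euler_lagrangeE U L p u2 : open U -> smooth_on U L -> autonomous_on U L ->
  U p -> partial iu1 (partial iu1 L) p != 0 ->
  euler_lagrange L p u2 <-> u2 = lagrange_phi L p.
Proof.
move=> oU sL aL Up L0.
have ex := autonomous_partial_x oU (autonomous_partial iu1 oU aL) Up.
have euv := partial_comm iu iu1 oU sL Up.
exact: solve_euler_lagrange ex euv L0.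
Qed.

(** The letters [x y z] stand for the partials of [L], [w1 w2 w3] for those of [L_{u_1}], [w2'] for
    the mixed partial in the other order, and [v0 v1 v2] for the components of the tangent vector.
    The terms in [z] cancel. *)
Fact energy_diff_identity (u x y z w1 w2 w2' w3 v0 v1 v2 : R) :
  u != 0 -> w3 != 0 -> x = 0 -> w1 = 0 -> w2 = w2' ->
  u * (v0 * w1 + v1 * w2 + v2 * w3) + z * v2 - (v0 * x + v1 * y + v2 * z) =
  u * w3 * (- ((y - u * w2') / w3 / u) * v1 + v2).
Proof. by move=> n0 n3 -> -> ->; field; rewrite n0 n3. Qed.

Lemma energy_diff U L p v : open U -> smooth_on U L -> autonomous_on U L ->
  energy_domain U p -> partial iu1 (partial iu1 L) p != 0 ->
  'd (energy_function L) p v =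
  u1coord p * partial iu1 (partial iu1 L) p * omega3 (lagrange_phi L) p v.
Proof.
move=> oU sL aL [Up u0] L0.
have sL1 : smooth_on U (partial iu1 L) by exact: smooth_partial.
have dL : differentiable L p by exact: smooth_differentiable sL Up.
have dL1 : differentiable (partial iu1 L) p by exact: smooth_differentiable sL1 Up.
have du : differentiable (u1coord : J1 -> R) p by exact: differentiable_coord.
have du1 : 'd u1coord p v = v ord0 iu1.
  by rewrite -deriveE// -(@derive_row _ _ _ id) ?derive_id.
have -> : 'd (energy_function L) p v =
    u1coord p * 'd (partial iu1 L) p v + partial iu1 L p * v ord0 iu1 - 'd L p v.
  rewrite (@diffB _ _ _ (u1coord * partial iu1 L) L)//; last exact: differentiableM.
  by rewrite !fctE diffM// !fctE -du1.
rewrite /omega3 /lagrange_phi (diff_partials v dL) (diff_partials v dL1).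
have ex := autonomous_partial_x oU aL Up.
have ex1 := autonomous_partial_x oU (autonomous_partial iu1 oU aL) Up.
have euv := partial_comm iu iu1 oU sL Up.
exact: energy_diff_identity u0 L0 ex ex1 euv.
Qed.

Lemma energy_defines_foliation U L : open U -> smooth_on U L ->
  autonomous_on U L -> (forall p, U p -> partial iu1 (partial iu1 L) p != 0) ->
  defines_energy_foliation U (lagrange_phi L) (energy_function L).
Proof.
move=> oU sL aL Lreg; have oM := open_energy_domain oU.
have MU : energy_domain U `<=` U by move=> p [].
split; first exact: smoothS MU (smooth_energy_function oU sL).
exists (fun p => u1coord p * partial iu1 (partial iu1 L) p); split.
- apply: smoothM => //; first exact: smooth_coord.
  by apply: smoothS MU _; do 2!apply: smooth_partial.
- by move=> p [Up u0]; rewrite mulf_neq0// Lreg.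
- by move=> p Mp v; apply: (energy_diff v oU) => //; apply: Lreg; exact: MU.
Qed.

End Energy.

(** * Leaves and level sets *)

Section Normed.
Context {R : realType}.

Lemma row_norm_coord n (v : 'rV[R]_n) i : `|v ord0 i| <= `|v|.
Proof.
rewrite [leRHS]/Num.norm /= mx_normrE.
exact: (@le_bigmax _ _ _ 0 (fun ij : 'I_1 * 'I_n => `|v ij.1 ij.2|) (ord0, i)).
Qed.

Lemma row_norm_le n (v : 'rV[R]_n) r : 0 <= r ->
  (forall i, `|v ord0 i| <= r) -> `|v| <= r.
Proof.
move=> r0 vr; rewrite [leLHS]/Num.norm /= mx_normrE.
by apply: bigmax_le => // -[i j] _ /=; rewrite ord1.
Qed.

Lemma row_norm_lt n (v : 'rV[R]_n) r : 0 < r ->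
  (forall i, `|v ord0 i| < r) -> `|v| < r.
Proof.
move=> r0 vr; rewrite [ltLHS]/Num.norm /= mx_normrE.
by apply: bigmax_lt => // -[i j] _ /=; rewrite ord1.
Qed.

Lemma segment_ball (V : normedModType R) (c p q : V) (r t : R) : 0 <= t <= 1 ->
  `|c - p| < r -> `|c - q| < r -> `|c - (p + t *: (q - p))| < r.
Proof.
move=> /andP[t0 t1] cp cq.
have -> : c - (p + t *: (q - p)) = (1 - t) *: (c - p) + t *: (c - q).
  rewrite scalerBl scale1r opprD addrA -[RHS]addrA; congr (_ + _).
  by rewrite -!scalerN !opprB -scalerDr subrKA.
apply: le_lt_trans (ler_normD _ _) _.
rewrite !normrZ (ger0_norm t0) ger0_norm ?subr_ge0//.
(* Strictness is drawn from the second summand alone, which requires [t] to be positive. *)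
have [->|tn0] := eqVneq t 0; first by rewrite subr0 mul1r mul0r addr0.
have tp : 0 < t by rewrite lt0r tn0.
have h1 : (1 - t) * `|c - p| <= (1 - t) * r.
  by rewrite ler_wpM2l ?subr_ge0// ltW.
have h2 : t * `|c - q| < t * r by rewrite ltr_pM2l.
by move: (ler_ltD h1 h2); rewrite -mulrDl subrK mul1r.
Qed.

(** The hypothesis says that [f x - f a] is [o(x - a)], so the zero map is the differential. *)
Lemma flat_diff (V W : normedModType R) (f : V -> W) (a : V) :
  (forall e, 0 < e -> \forall x \near a, `|f x - f a| <= e * `|x - a|) ->
  differentiable f a /\ forall v, 'd f a v = 0.
Proof.
move=> fa.
have H : f \o shift a = cst (f a) + \0 +o_ 0 id.
  apply/eqaddoP => e e0.
  have fe : \forall h \near (0 : V), `|f (h + a) - f a| <= e * `|h|.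
    have /nbhs_normP[r /= r0 fr] := fa _ e0; apply/nbhs_normP; exists r => //= h /=.
    rewrite sub0r normrN => hr; have := fr (h + a); rewrite /= addrK; apply.
    by rewrite opprD addrCA subrr addr0 normrN.
  by apply: filterS fe => h; rewrite !fctE /= addr0.
have c0 : continuous (\0 : V -> W) by move=> x; exact: cst_continuous.
have dE : 'd f a = \0 :> (V -> W) by exact: diff_unique c0 H.
split; last by move=> v; rewrite dE.
by apply/diff_locallyP; rewrite dE.
Qed.

End Normed.

(** * First integrals are constant on leaves *)

Section FirstIntegral.
Context {R : realType}.
Variables (M : set 'rV[R]_3) (D : 'rV[R]_3 -> set 'rV[R]_3) (E : 'rV[R]_3 -> R).
Hypothesis dE : forall p, M p -> differentiable E p.
Hypothesis E0 : forall p v, M p -> D p v -> 'd E p v = 0.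

(** In a chart [E] has zero differential, hence is constant on balls. With [T] arbitrary, a level
    set and its complement are both covered, as [connected_atlas] demands. *)
Lemma first_integral_chart_open c (T : set R) : integral_chart M D c ->
  open (surface_dom c `&` surface_map c @^-1` (E @^-1` T)).
Proof.
case=> odom smap _ cM cD.
set F := E \o surface_map c.
have Mb b : surface_dom c b -> M (surface_map c b).
  by move=> db; apply: cM; exists b.
have dmap b : surface_dom c b -> differentiable (surface_map c) b.
  by move=> db; exact: (smap 0%N).1.
have dF b : surface_dom c b -> differentiable F b.
  by move=> db; apply: differentiable_comp; [exact: dmap|exact/dE/Mb].
have F0 b v : surface_dom c b -> 'd F b v = 0.
  move=> db; rewrite (diff_comp (dmap _ db) (dE (Mb _ db))) /=.
  by apply: E0; [exact: Mb|rewrite -cD//; exists v].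
rewrite openE => b [db Tb].
have /nbhs_normP[r /= r0 rdom] := open_nbhs_nbhs (conj odom db).
suff : \forall b' \near b, surface_dom c b' /\ T (F b') by [].
apply/nbhs_normP; exists r => //= b' bb'; split; first exact: rdom.
have dseg (t : R) : 0 <= t <= 1 -> surface_dom c (b + t *: (b' - b)).
  by move=> t01; apply: rdom; apply: segment_ball => //=; rewrite subrr normr0.
have [t t01|t t01] := @segment_MVT R _ F b b'; first by exact/dF/dseg.
rewrite F0; last exact: dseg.
by move=> /eqP; rewrite subr_eq0 /F /= => /eqP ->.
Qed.

Lemma first_integral_leaf p q : leaf M D p q -> E q = E p.
Proof.
move=> [A [[chartA _] connA Ap Aq]].
have [|AS|AS] := connA [set r | E r = E p].
- move=> c /chartA hc; split.
  + exact: (@first_integral_chart_open _ [set x | x = E p] hc).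
  + exact: (@first_integral_chart_open _ [set x | x <> E p] hc).
- exact: AS Aq.
- by have := AS _ Ap; case.
Qed.

End FirstIntegral.

Lemma ball_clopen (R : realType) (V : normedModType R) (c : V) (r : R) (T : set V) :
  let B := [set b | `|c - b| < r] in
  open (B `&` T) -> open (B `&` ~` T) ->
  forall a b, B a -> B b -> T a -> T b.
Proof.
move=> B oT oTC a b Ba Bb Ta.
(* The indicator function of [T] has zero differential on the ball. *)
pose f x : R := `[< T x >]%:R.
have df x : B x -> differentiable f x /\ forall v, 'd f x v = 0.
  move=> Bx; apply: flat_diff => e e0.
  suff : \forall y \near x, f y = f x.
    by apply: filterS => y ->; rewrite subrr normr0 mulr_ge0// ltW.
  have [Tx|nTx] := pselect (T x).
    apply: filterS (open_nbhs_nbhs (conj oT (conj Bx Tx))) => y [_ Ty].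
    by rewrite /f !asboolT.
  apply: filterS (open_nbhs_nbhs (conj oTC (conj Bx nTx))) => y [_ nTy].
  by rewrite /f !asboolF.
have [t t01|t t01] := @segment_MVT R V f a b.
  by apply: (df _ _).1; exact: segment_ball.
have [_ ->] := df _ (segment_ball t01 Ba Bb).
rewrite /f (asboolT Ta) => /eqP; rewrite subr_eq0.
by case: asboolP => // _; rewrite eq_sym oner_eq0.
Qed.

(** * The jet space as the [(x, u)]-plane times the [u_1]-axis, and graphs over the plane *)

Section Graph.
Context {R : realType}.
Local Notation J1 := 'rV[R]_3.

Definition base (p : J1) : 'rV[R]_2 :=
  \row_i nth 0 [:: p ord0 ix; p ord0 iu] i.

Definition point_over (b : 'rV[R]_2) (t : R) : J1 :=
  \row_i nth 0 [:: b ord0 0; b ord0 1; t] i.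

Lemma baseK p : point_over (base p) (u1coord p) = p.
Proof.
apply/rowP => -[[|[|[|//]]] i3]; rewrite !mxE /= ?mxE//=;
  by congr (p _ _); exact/val_inj.
Qed.

Lemma overK b t : base (point_over b t) = b.
Proof.
apply/rowP => -[[|[|//]] i2]; rewrite !mxE /= ?mxE//=;
  by congr (b _ _); exact/val_inj.
Qed.

Lemma u1coord_over b t : u1coord (point_over b t) = t.
Proof. by rewrite /u1coord mxE. Qed.

Lemma ucoord_over b t : ucoord (point_over b t) = b ord0 1.
Proof. by rewrite /ucoord mxE. Qed.

Lemma over_norm_lt p b t r :
  `|base p - b| < r -> `|u1coord p - t| < r -> `|p - point_over b t| < r.
Proof.
move=> pb pt; have r0 : 0 < r by exact: le_lt_trans pb.
apply: row_norm_lt => // -[[|[|[|//]]] i3]; rewrite !mxE /=.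
- apply: le_lt_trans pb; apply: le_trans (row_norm_coord _ 0).
  by rewrite !mxE /= (_ : Ordinal i3 = ix)//; exact/val_inj.
- apply: le_lt_trans pb; apply: le_trans (row_norm_coord _ 1).
  by rewrite !mxE /= (_ : Ordinal i3 = iu)//; exact/val_inj.
- by rewrite (_ : Ordinal i3 = iu1)//; exact/val_inj.
Qed.

Lemma base_norm_le p q : `|base p - base q| <= `|p - q|.
Proof.
apply: row_norm_le => // -[[|[|//]] i2]; rewrite !mxE /=.
- by rewrite (le_trans _ (row_norm_coord (p - q) ix))// !mxE.
- by rewrite (le_trans _ (row_norm_coord (p - q) iu))// !mxE.
Qed.

Lemma over_norm_le b c t u r : `|b - c| <= r -> `|t - u| <= r ->
  `|point_over b t - point_over c u| <= r.
Proof.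
move=> bc tu; have r0 : 0 <= r by exact: le_trans bc.
apply: row_norm_le => // -[[|[|[|//]]] i3]; rewrite !mxE //=.
- by apply: le_trans bc; apply: le_trans (row_norm_coord _ 0); rewrite !mxE.
- by apply: le_trans bc; apply: le_trans (row_norm_coord _ 1); rewrite !mxE.
Qed.

Lemma dist_continuous (V W : normedModType R) (f : V -> W) (p : V) :
  (forall q, `|f p - f q| <= `|p - q|) -> {for p, continuous f}.
Proof.
move=> fp; apply/cvgrPdist_lt => e e0; apply/nbhs_normP; exists e => //= q.
exact: le_lt_trans (fp q).
Qed.

Lemma continuous_base p : {for p, continuous base}.
Proof. by apply: dist_continuous => q; exact: base_norm_le. Qed.

Lemma continuous_over b t : {for b, continuous (point_over^~ t)}.
Proof. by apply: dist_continuous => c; rewrite over_norm_le// subrr normr0. Qed.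

Lemma continuous_over_u1 b t : {for t, continuous (point_over b)}.
Proof. by apply: dist_continuous => u; rewrite over_norm_le// subrr normr0. Qed.

Lemma continuous_u1coord p : {for p, continuous (@u1coord R)}.
Proof. exact: coord_continuous. Qed.

End Graph.

Section GraphCalculus.
Context {R : realType}.
Implicit Types (A : set 'rV[R]_2) (g : 'rV[R]_2 -> R).

Lemma diff_coord n (b v : 'rV[R]_n) i : 'd (fun c : 'rV[R]_n => c ord0 i) b v = v ord0 i.
Proof.
rewrite -deriveE; last exact: differentiable_coord.
by rewrite -(@derive_row _ _ _ id) ?derive_id.
Qed.

Lemma over_coordE g (i : 'I_3) :
  (fun b : 'rV[R]_2 => point_over b (g b) ord0 i) =
  nth (cst 0) [:: (fun b : 'rV[R]_2 => b ord0 0); (fun b : 'rV[R]_2 => b ord0 1); g] i.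
Proof. by apply/funext => b; rewrite mxE; case: i => -[|[|[|]]]. Qed.

Lemma upto_over k A g : open A -> differentiable_upto k A g ->
  differentiable_upto k A (fun b => point_over b (g b)).
Proof.
move=> oA hg; apply/upto_rowP => // i; rewrite over_coordE.
by case: i => -[|[|[|//]]] i3 //=; exact: upto_coord.
Qed.

Lemma differentiable_over g b :
  differentiable g b -> differentiable (fun c => point_over c (g c)) b.
Proof.
move=> dg; apply/differentiable_rowP => i; rewrite over_coordE.
by case: i => -[|[|[|//]]] i3 //=; exact: differentiable_coord.
Qed.

Lemma diff_over g b v : differentiable g b ->
  'd (fun c => point_over c (g c)) b v = point_over v ('d g b v).
Proof.
move=> dg; have dG := differentiable_over dg.
apply/rowP => i; rewrite -deriveE// derive_row// over_coordE mxE.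
case: i => -[|[|[|//]]] i3 /=; rewrite deriveE ?diff_coord//.
- exact: differentiable_coord.
- exact: differentiable_coord.
Qed.

End GraphCalculus.

Fact affine_remainder (R : comNzRingType) (x y k a b : R) :
  x - k * a - (y - k * b) = x - y - k * (a - b).
Proof. by ring. Qed.

(** Here [e0], [et], [eb] are the values of [E] at the centre, top and bottom of a vertical segment,
    and [vt], [vb] those at the ends of a nearby segment. As [h] is at most half of either gap,
    moving the ends and the level by less than [h] preserves their order. *)
Fact between_of_close (R : realFieldType) (e0 et eb vt vb c h : R) :
  h * 2 <= et - e0 -> h * 2 <= e0 - eb -> `|et - vt| < h -> `|eb - vb| < h ->
  `|e0 - c| < h -> vb < c < vt.
Proof.
rewrite !ltr_norml => h1 h2 /andP[a1 a2] /andP[b1 b2] /andP[c1 c2].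
by apply/andP; split; lra.
Qed.

(** * Level sets of a first integral as graphs inside leaves *)

Section LevelSets.
Context {R : realType}.
Variables (U : set 'rV[R]_3) (phi E mu : 'rV[R]_3 -> R).
Local Notation M := (energy_domain U).
Local Notation psi := (fun p => phi p / u1coord p).
Hypothesis oM : open M.
Hypothesis spsi : smooth_on M psi.
Hypothesis dE : forall p, M p -> differentiable E p.
Hypothesis diffE_omega : forall p, M p -> forall v, 'd E p v = mu p * omega3 phi p v.
Hypothesis mu_neq0 : forall p, M p -> mu p != 0.

Section Box.
Variables (p0 : 'rV[R]_3) (r K : R).
Hypothesis box_dom : forall q, `|p0 - q| < r -> M q.
Hypothesis box_psi : forall q, `|p0 - q| < r -> `|psi q| <= K.

(** The mean value theorem with [dE = mu omega^3]. The bound on [x] makes it tend to [q] as [q']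
    does, which identifies the differential in [graph_diff]. *)
Lemma box_slope q q' : `|p0 - q| < r -> `|p0 - q'| < r ->
  exists x, [/\ `|p0 - x| < r, `|q - x| <= `|q - q'| &
    E q' - E q =
    mu x * (u1coord q' - u1coord q - psi x * (ucoord q' - ucoord q))].
Proof.
move=> qr q'r.
have seg (t : R) (t01 : 0 <= t <= 1) := segment_ball t01 qr q'r.
have [t t01|t t01 ->] := @segment_MVT R _ E q q'; first exact/dE/box_dom/seg.
exists (q + t *: (q' - q)); split; first exact: seg.
  rewrite opprD addNKr normrN normrZ distrC.
  by case/andP: t01 => t0 t1; rewrite (ger0_norm t0) ler_piMl.
rewrite diffE_omega; last exact/box_dom/seg.
congr (_ * _); rewrite /omega3 mulNr [LHS]addrC.
by rewrite !mxE.
Qed.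

(** Along a vertical line [du] vanishes, so the increment of [E] is a nonzero multiple of
    [t' - t]. *)
Lemma box_inj b t t' : `|p0 - point_over b t| < r -> `|p0 - point_over b t'| < r ->
  E (point_over b t) = E (point_over b t') -> t = t'.
Proof.
move=> bt bt' Ett'; have [x [xr _]] := box_slope bt bt'.
rewrite Ett' !ucoord_over !u1coord_over !subrr mulr0 subr0 => /esym/eqP.
by rewrite mulf_eq0 (negbTE (mu_neq0 (box_dom xr)))/= subr_eq0 => /eqP.
Qed.

Section LevelGraph.
Variables (d C : R) (g : 'rV[R]_2 -> R).
Local Notation B := [set b | `|base p0 - b| < d].
Local Notation G := (fun b => point_over b (g b)).
Hypothesis graph_box : forall b, B b -> `|p0 - point_over b (g b)| < r.
Hypothesis graph_level : forall b, B b -> E (point_over b (g b)) = C.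

Lemma open_graph_dom : open B.
Proof.
rewrite (_ : B = ball (base p0) d); first exact: ball_open.
by rewrite -ball_normE.
Qed.

(* Applying the mean value theorem to [E] between two points of the same level
   yields at once that [g] is Lipschitz and that [dg = psi du]. *)
Lemma graph_slope b c : B b -> B c ->
  exists x, [/\ `|p0 - x| < r, `|G b - x| <= `|G b - G c| &
    g c - g b = psi x * (c ord0 1 - b ord0 1)].
Proof.
move=> Bb Bc.
have [x [xr xb]] := box_slope (graph_box Bb) (graph_box Bc).
rewrite !graph_level// !ucoord_over !u1coord_over subrr => /esym/eqP.
rewrite mulf_eq0 (negbTE (mu_neq0 (box_dom xr)))/= subr_eq0 => /eqP xE.
by exists x; split.
Qed.

(** In the maximum norm the base components contribute the constant 1 and the height contributes
    [K]; [1 + K] dominates both. *)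
Lemma graph_lipschitz b c : B b -> B c -> `|G b - G c| <= (1 + K) * `|b - c|.
Proof.
move=> Bb Bc; have [x [xr _ xE]] := graph_slope Bb Bc.
have K0 : 0 <= K by exact: le_trans (box_psi xr).
apply: over_norm_le.
  by rewrite mulrDl mul1r lerDl mulr_ge0.
rewrite distrC xE normrM mulrDl mul1r -[leLHS]add0r lerD// ler_pM ?box_psi//.
by rewrite distrC (le_trans _ (row_norm_coord (b - c) 1))// !mxE.
Qed.

(** Subtracting the candidate [psi (G b) du] from [g] leaves an increment [(psi x - psi (G b)) du].
    By the Lipschitz bound [x] tends to [G b], so continuity of [psi] makes this increment flat. *)
Lemma graph_diff b : B b ->
  differentiable g b /\ forall v, 'd g b v = psi (G b) * v ord0 1.
Proof.
move=> Bb; have MG : M (G b) by exact/box_dom/graph_box.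
have K0 : 0 <= K by apply: le_trans (box_psi (graph_box Bb)).
have K1 : 0 < 1 + K by rewrite ltr_pwDl.
pose f c := g c - psi (G b) * c ord0 1.
have [df f0] : differentiable f b /\ forall v, 'd f b v = 0.
  apply: flat_diff => e e0.
  have cpsi : {for G b, continuous psi}.
    by apply: differentiable_continuous; exact: (spsi 0%N).1.
  have : \forall q \near G b, `|psi (G b) - psi q| < e.
    by move/cvgrPdist_lt: cpsi => /(_ _ e0).
  move=> /nbhs_normP[s /= s0 sP].
  have /nbhs_normP[s' /= s'0 s'P] := open_nbhs_nbhs (conj open_graph_dom Bb).
  apply/nbhs_normP; exists (Num.min s' (s / (1 + K))).
    by rewrite /= lt_min s'0 divr_gt0.
  move=> c /=; rewrite lt_min => /andP[/s'P/= Bc bc].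
  have [x [xr xb xE]] := graph_slope Bb Bc.
  have xs : `|G b - x| < s.
    apply: le_lt_trans xb _; apply: le_lt_trans (graph_lipschitz Bb Bc) _.
    by rewrite mulrC -ltr_pdivlMr.
  have -> : f c - f b = (psi x - psi (G b)) * (c ord0 1 - b ord0 1).
    by rewrite mulrBl -xE; exact: affine_remainder.
  rewrite normrM ler_pM//; first by rewrite distrC ltW// sP.
  by rewrite (le_trans _ (row_norm_coord (c - b) 1))// !mxE.
set k := psi (G b) in f df f0 *.
have gE : f + k \*: (fun c : 'rV[R]_2 => c ord0 1) = g.
  by apply/funext => c; rewrite !fctE /f subrK.
have dc : differentiable (fun c : 'rV[R]_2 => c ord0 1) b.
  exact: differentiable_coord.
have dkc := differentiableZ k dc.
rewrite -gE; split; first exact: differentiableD.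
move=> v; rewrite (diffD df dkc) (diffZ k dc).
transitivity ('d f b v + k * 'd (fun c : 'rV[R]_2 => c ord0 1) b v) => //.
by rewrite (f0 v) diff_coord add0r.
Qed.

(** Bootstrap: ['D_v g] is [psi \o G] times a constant, hence as regular as [g] itself. *)
Lemma smooth_graph : smooth_on B G.
Proof.
move=> k; apply: upto_over; first exact: open_graph_dom.
elim: k => [|k IH]; (split; first by move=> b /graph_diff[]) => // v.
apply: (@upto_eq _ _ _ _ _ ((psi \o G) * cst (v ord0 1))).
- exact: open_graph_dom.
- by move=> b /graph_diff[dg gv]; rewrite deriveE// gv.
apply: uptoM; [exact: open_graph_dom| |exact: upto_cst].
apply: upto_comp spsi _ (upto_over open_graph_dom IH); first exact: open_graph_dom.
by move=> b Bb; exact/box_dom/graph_box.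
Qed.

Lemma graph_range b : B b -> range ('d G b) = energy_distribution phi (G b).
Proof.
move=> Bb; have [dg gv] := graph_diff Bb.
apply/seteqP; split=> [_ [v _ <-]|w w0].
  by rewrite diff_over// gv /energy_distribution /omega3 /mkset !mxE /= mulNr addNr.
(* A vector killed by [omega3] is determined by its base components, its [u_1] component being [psi]
   times the [u] one. *)
exists (base w) => //; rewrite diff_over// gv.
rewrite -[RHS]baseK; congr (point_over _ _).
rewrite mxE /=; move: w0; rewrite /energy_distribution /= /omega3 mulNr => /eqP.
by rewrite addrC subr_eq0 => /eqP.
Qed.

Lemma graph_chart : integral_chart M (energy_distribution phi) (Surface B G).
Proof.
split => /=.
- exact: open_graph_dom.
- exact: smooth_graph.
- by move=> b c _ _ /(congr1 base); rewrite !overK.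
- by move=> _ [b Bb <-]; exact/box_dom/graph_box.
- exact: graph_range.
Qed.

(** The graph is an atlas with a single chart: [base] inverts [G], so the transition map is the
    identity, and connectedness is that of the ball [B]. *)
Lemma graph_leaf b c : B b -> B c -> energy_leaf U phi (G b) (G c).
Proof.
move=> Bb Bc; exists [set Surface B G]; split.
- split=> [_ ->|_ _ O -> -> oO OB /=]; first exact: graph_chart.
  rewrite (_ : _ `&` _ = O)//; apply/seteqP; split=> [a [_ [a' Oa' /= aa']]|a Oa].
    by have := congr1 base aa'; rewrite !overK => <-.
  by split; [exact: OB|exists a].
- move=> S hS; have /= [oS oSC] := hS _ erefl.
  have BS := ball_clopen oS oSC; have [Sb|nSb] := pselect (S (G b)).
    by left=> _ [_ -> [a /= Ba <-]]; exact: BS Bb Ba Sb.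
  by right=> _ [_ -> [a /= Ba <-]] Sa; apply: nSb; exact: BS Ba Bb Sa.
- by exists (Surface B G) => //; exists b.
- by exists (Surface B G) => //; exists c.
Qed.

End LevelGraph.
End Box.

Lemma local_level_sets p0 : M p0 -> 0 < mu p0 -> {for p0, continuous mu} ->
  exists W : set 'rV[R]_3, [/\ open W, W p0, W `<=` M &
    forall q, W q -> energy_leaf U phi q `&` W = [set s | W s /\ E s = E q]].
Proof.
move=> Mp0 mu_gt0 cmu.
have cpsi : {for p0, continuous psi}.
  by apply: differentiable_continuous; exact: (spsi 0%N).1.
have [r r0 box] : exists2 r, 0 < r & forall q, `|p0 - q| < r ->
    [/\ M q, `|psi q| <= `|psi p0| + 1 & 0 < mu q].
  have n1 := open_nbhs_nbhs (conj oM Mp0).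
  have n2 : \forall q \near p0, `|psi p0 - psi q| < 1.
    by move/cvgrPdist_lt: cpsi => /(_ _ ltr01).
  have n3 : \forall q \near p0, `|mu p0 - mu q| < mu p0.
    by move/cvgrPdist_lt: cmu => /(_ _ mu_gt0).
  have : \forall q \near p0, [/\ M q, `|psi p0 - psi q| < 1 & `|mu p0 - mu q| < mu p0].
    by apply: filterS (filterI n1 (filterI n2 n3)) => q [? [? ?]].
  move=> /nbhs_normP[r /= r0 rP].
  exists r => // q /rP[Mq psiq muq]; split=> //.
    rewrite addrC -lerBlDr (le_trans (lerB_dist _ _))// distrC ltW//.
  by move: muq; rewrite ltr_norml => /andP[_]; rewrite ltrBlDr ltrDl.
have box_dom q (qr : `|p0 - q| < r) : M q by have [] := box q qr.
have box_psi q (qr : `|p0 - q| < r) : `|psi q| <= `|psi p0| + 1 by have [] := box q qr.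
have box_mu q (qr : `|p0 - q| < r) : 0 < mu q by have [] := box q qr.
pose b0 := base p0; pose t0 := u1coord p0.
have p0E : p0 = point_over b0 t0 by rewrite baseK.
(* Half the radius, so that the closed segment of heights from [t0 - e] to [t0 + e] stays in the
   open box. *)
pose e := r / 2.
have e0 : 0 < e by rewrite divr_gt0.
have er : e < r by rewrite ltr_pdivrMr// ltr_pMr// ltr1n.
(* [E] increases along the vertical line through [p0], which places [E p0] strictly between [bot]
   and [top]. *)
have vertical t : `|t0 - t| < r -> exists2 m, 0 < m &
    E (point_over b0 t) - E p0 = m * (t - t0).
  move=> tr.
  have p0r : `|p0 - p0| < r by rewrite subrr normr0.
  have tr' : `|p0 - point_over b0 t| < r.
    by apply: over_norm_lt => //; rewrite subrr normr0.
  have [x [xr _ xE]] := box_slope box_dom p0r tr'.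
  exists (mu x); first exact: box_mu.
  rewrite xE ucoord_over u1coord_over.
  have -> : b0 ord0 1 = ucoord p0 by rewrite mxE.
  by rewrite subrr mulr0 subr0.
have [top [topE topl]] : exists v, v = E (point_over b0 (t0 + e)) /\ E p0 < v.
  have [|m m0 mE] := vertical (t0 + e).
    by rewrite opprD addNKr normrN gtr0_norm.
  exists (E (point_over b0 (t0 + e))); split=> //.
  by rewrite -subr_gt0 mE addrAC subrr add0r mulr_gt0.
have [bot [botE botl]] : exists v, v = E (point_over b0 (t0 - e)) /\ v < E p0.
  have [|m m0 mE] := vertical (t0 - e).
    by rewrite opprB addrC subrK gtr0_norm.
  exists (E (point_over b0 (t0 - e))); split=> //.
  by rewrite -subr_lt0 mE addrAC subrr add0r mulrN oppr_lt0 mulr_gt0.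
pose h := Num.min (top - E p0) (E p0 - bot) / 2.
have h0 : 0 < h by rewrite divr_gt0// lt_min !subr_gt0 topl botl.
have htop : h * 2 <= top - E p0 by rewrite divfK// ge_min lexx.
have hbot : h * 2 <= E p0 - bot by rewrite divfK// ge_min lexx orbT.
have cE t : `|t0 - t| < r -> {for b0, continuous (fun b => E (point_over b t))}.
  move=> tr; apply: continuous_comp; first exact: continuous_over.
  apply/differentiable_continuous/dE/box_dom/over_norm_lt => //.
  by rewrite subrr normr0.
have t0top : `|t0 - (t0 + e)| < r by rewrite opprD addNKr normrN gtr0_norm.
have t0bot : `|t0 - (t0 - e)| < r by rewrite opprB addrC subrK gtr0_norm.
have [d1 d10 d1P] : exists2 d, 0 < d & forall b, `|b0 - b| < d ->
    `|top - E (point_over b (t0 + e))| < h /\ `|bot - E (point_over b (t0 - e))| < h.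
  have n1 : \forall b \near b0, `|top - E (point_over b (t0 + e))| < h.
    by move/cvgrPdist_lt: (cE _ t0top) => /(_ _ h0); rewrite -topE.
  have n2 : \forall b \near b0, `|bot - E (point_over b (t0 - e))| < h.
    by move/cvgrPdist_lt: (cE _ t0bot) => /(_ _ h0); rewrite -botE.
  have : \forall b \near b0, `|top - E (point_over b (t0 + e))| < h /\
      `|bot - E (point_over b (t0 - e))| < h by exact: filterI n1 n2.
  by move=> /nbhs_normP[d /= d0 dP]; exists d => // b /dP.
pose d := Num.min d1 r.
have d0 : 0 < d by rewrite lt_min d10.
pose B : set 'rV[R]_2 := [set b | `|b0 - b| < d].
have Br b : B b -> `|b0 - b| < r by rewrite /B /= lt_min => /andP[].
have solve C b : `|E p0 - C| < h -> B b ->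
    exists t, `|t0 - t| < e /\ E (point_over b t) = C.
  move=> Ch Bb.
  have [h1 h2] : `|top - E (point_over b (t0 + e))| < h /\
      `|bot - E (point_over b (t0 - e))| < h.
    by apply: d1P; move: Bb; rewrite /B /= lt_min => /andP[].
  have /andP[lo hi] := between_of_close htop hbot h1 h2 Ch.
  have le : t0 - e <= t0 + e by rewrite lerD2l ge0_cp// ltW.
  have [||t tI tE] := @IVT R (fun t => E (point_over b t)) (t0 - e) (t0 + e) C le.
  - apply: continuous_in_subspaceT => t /[!inE] /= tI.
    apply: continuous_comp; first exact: continuous_over_u1.
    apply/differentiable_continuous/dE/box_dom/over_norm_lt; first exact: Br.
    by apply: le_lt_trans er; rewrite distrC ler_distl; rewrite in_itv/= in tI.
  - by rewrite ge_min le_max (ltW lo) (ltW hi) orbT.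
  exists t; split=> //.
  (* The intermediate value theorem gives a height in the closed segment; the strict bounds [lo] and
     [hi] exclude its ends. *)
  rewrite distrC ltr_distl; move: tI; rewrite in_itv /= !le_eqVlt => /andP[].
  move=> /predU1P[tt|->]; first by move: lo; rewrite -tE tt ltxx.
  by move=> /predU1P[tt|->//]; move: hi; rewrite -tE tt ltxx.
(* In the plain box a level set could have several components; the bound on
   [E] makes it a graph over the whole of [B]. *)
pose W : set 'rV[R]_3 := [set q | [/\ B (base q), `|t0 - u1coord q| < e &
  `|E p0 - E q| < h]].
have Wr q : W q -> `|p0 - q| < r.
  move=> [Bq tq _]; rewrite -(baseK q); apply: over_norm_lt; first exact: Br.
  exact: lt_trans er.
exists W; split.
- rewrite openE => q Wq; have [Bq tq hq] := Wq.
  have n1 : \forall s \near q, B (base s).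
    have nB : nbhs (base q) B.
      by apply: open_nbhs_nbhs; split=> //; exact: open_graph_dom.
    exact: continuous_base nB.
  have n2 : \forall s \near q, `|t0 - u1coord s| < e.
    have nt : nbhs (u1coord q) [set t | `|t0 - t| < e].
      apply: open_nbhs_nbhs; split=> //.
      by rewrite (_ : [set t | _] = ball t0 e)//; exact: ball_open.
    exact: continuous_u1coord nt.
  have n3 : \forall s \near q, `|E p0 - E s| < h.
    have nE : nbhs (E q) [set v | `|E p0 - v| < h].
      apply: open_nbhs_nbhs; split=> //.
      by rewrite (_ : [set v | _] = ball (E p0) h)//; exact: ball_open.
    have cEq : {for q, continuous E} by exact/differentiable_continuous/dE/box_dom/Wr.
    exact: cEq nE.
  suff : \forall s \near q, W s by [].
  by apply: filterS (filterI n1 (filterI n2 n3)) => s [? [? ?]]; split.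
- by split; rewrite /B /= ?subrr ?normr0.
- by move=> q /Wr/box_dom.
move=> q Wq; apply/seteqP; split=> s /=.
  move=> [lqs Ws]; split=> //;
  apply: (@first_integral_leaf R M (energy_distribution phi) E dE _ q s lqs).
  by move=> p v Mp pv; rewrite diffE_omega// pv mulr0.
move=> [Ws Esq]; split=> //.
have [_ _ hq] := Wq.
(* The height 0 off [B] is a dummy value; every property of the graph is asserted on [B] only. *)
have /choice[g gP] : forall b, exists t, B b ->
    `|t0 - t| < e /\ E (point_over b t) = E q.
  move=> b; have [Bb|nBb] := pselect (B b); last by exists 0.
  by have [t tP] := solve _ _ hq Bb; exists t.
have graph_box b : B b -> `|p0 - point_over b (g b)| < r.
  move=> Bb; apply: over_norm_lt; first exact: Br.
  by apply: lt_trans er; have [] := gP b Bb.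
have graph_level b : B b -> E (point_over b (g b)) = E q.
  by move=> Bb; have [] := gP b Bb.
(* By uniqueness of the height, every point of [W] on the level of [q] is on this graph. *)
have on_graph s' : W s' -> E s' = E q -> s' = point_over (base s') (g (base s')).
  move=> Ws' Es'; have [Bs' _ _] := Ws'.
  have bs : `|p0 - point_over (base s') (u1coord s')| < r by rewrite baseK; exact: Wr.
  rewrite -{1}(baseK s'); congr point_over.
  by apply: (box_inj box_dom bs (graph_box _ Bs')); rewrite baseK graph_level.
rewrite (on_graph q)// (on_graph s)//.
apply: (graph_leaf box_dom box_psi graph_box graph_level).
- by have [] := Wq.
- by have [] := Ws.
Qed.

End LevelSets.

Lemma energy_foliation_level_sets (R : realType) (U : set 'rV[R]_3)
    (phi E : 'rV[R]_3 -> R) : open U -> smooth_on U phi ->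
  defines_energy_foliation U phi E -> leaves_locally_level_sets U phi E.
Proof.
move=> oU sphi [sE [mu [smu mu0 Emu]]] p Mp.
have oM := open_energy_domain oU.
have spsi : smooth_on (energy_domain U) (fun q => phi q / u1coord q).
  apply: smooth_div => //; last exact: smooth_coord.
  - by move=> q [].
  - by apply: smoothS sphi => q [].
have dE q : energy_domain U q -> differentiable E q by exact: smooth_differentiable sE.
have cmu : {for p, continuous mu}.
  by apply: differentiable_continuous; exact: smooth_differentiable smu Mp.
split.
  (* On the [u_1] direction [omega3] takes the value 1. *)
  exists (delta_mx ord0 iu1); rewrite Emu// mulf_neq0 ?mu0//.
  by rewrite /omega3 !mxE /= mulr0 add0r oner_neq0.
have [mup|] := ltP 0 (mu p); first exact: local_level_sets mup cmu.
(* For negative [mu p], pass to [- E] and [- mu], which have the same level sets and the same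
   distribution. *)
rewrite le_eqVlt (negbTE (mu0 _ Mp)) /= => mup.
have dNE q : energy_domain U q -> differentiable (- E) q.
  by move=> /dE; exact: differentiableN.
have ENmu q : energy_domain U q -> forall v,
    'd (- E) q v = - mu q * omega3 phi q v.
  by move=> Mq v; rewrite diffN ?fctE ?Emu ?mulNr//; exact: dE.
have Nmu0 q : energy_domain U q -> - mu q != 0 by move=> Mq; rewrite oppr_eq0 mu0.
have Nmup : 0 < - mu p by rewrite oppr_gt0.
have cNmu : {for p, continuous (fun q => - mu q)} by exact: continuousN.
have [W [oW Wp WM leafW]] := local_level_sets oM spsi dNE ENmu Nmu0 Mp Nmup cNmu.
exists W; split=> // q Wq; rewrite leafW//.
by apply/seteqP; split=> s [Ws]; [move/oppr_inj|move=> Es]; split; rewrite ?fctE ?Es.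
Qed.

Unset Implicit Arguments.

Theorem theorem5p1 (R : realType) (U : set 'rV[R]_3) (L : 'rV[R]_3 -> R)
  (hU : open U)
  (hL : smooth_on U L)
  (hLaut : autonomous_on U L)
  (hLreg : forall p, U p -> partial iu1 (partial iu1 L) p != 0) :
  [/\ smooth_on U (lagrange_phi L),
      autonomous_on U (lagrange_phi L),
      forall p u2, U p -> (euler_lagrange L p u2 <-> u2 = lagrange_phi L p),
      defines_energy_foliation U (lagrange_phi L) (energy_function L) &
      leaves_locally_level_sets U (lagrange_phi L) (energy_function L)].
Proof.
have sphi := smooth_lagrange_phi hU hL hLreg.
have foliation := energy_defines_foliation hU hL hLaut hLreg.
split; [exact: sphi| | |exact: foliation|].
- exact: autonomous_lagrange_phi.
- by move=> p u2 Up; exact: euler_lagrangeE hU hL hLaut Up (hLreg p Up).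
- exact: energy_foliation_level_sets.
Qed.
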